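(* Let $S$ be a Prüfer semiring, and let $\operatorname{FId}(S)$ be the semiring of finitely generated ideals of $S$. Then the following statements hold: (1) $\operatorname{FId}(S)$ is a Gaussian semiring. (2) $\operatorname{FId}(S)$ is a subtractive semiring. (3) $\operatorname{FId}(S)$ is an additively idempotent semidomain, and for all finitely generated ideals $I$ and $J$ of $S$ we have $IJ\in (I^2,J^2)$, where $(I^2,J^2)$ denotes the ideal of the semiring $\operatorname{FId}(S)$ generated by its elements $I^2$ and $J^2$. (4) $\operatorname{FId}(S)$ is a Prüfer semiring.
   Context: A semiring is a set $S$ with operations $+,\cdot$ such that $(S,+)$ is a commutative monoid with identity $0$, $(S,\cdot)$ is a commutative monoid with identity $1\neq 0$, multiplication distributes over addition, and $s\cdot 0=0$ for all $s\in S$. It is additively idempotent if $s+s=s$ for all $s\in S$. An ideal of $S$ is a nonempty subset $I\subseteq S$ such that $a,b\in I$ and $s\in S$ imply $a+b, sa\in I$. An ideal $I$ is subtractive if $a+b\in I$ and $a\in I$ imply $b\in I$; a semiring is subtractive if all its ideals are subtractive. $\operatorname{FId}(S)$ is the set of finitely generated ideals of $S$ with the operations $I+J=\{a+b:a\in I,b\in J\}$ and $IJ=$ the set of finite sums $\sum a_ib_i$ with $a_i\in I$, $b_i\in J$; its zero is the zero ideal and its identity is $S$. An element $s\in S$ is multiplicatively cancellable (MC) if $sb=sc$ implies $b=c$ for all $b,c\in S$; $S$ is a semidomain if every nonzero element of $S$ is MC. For $f\in S[X]$, the content $c(f)$ is the ideal of $S$ generated by the coefficients of $f$; $S$ is Gaussian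 if $c(fg)=c(f)c(g)$ for all $f,g\in S[X]$. The total quotient semiring $Q(S)$ is the localization of $S$ at the set $M$ of its MC elements: the set of classes $a/b$ of pairs $(a,b)\in S\times M$ under $(a,b)\sim(c,d)$ iff $tad=tbc$ for some $t\in M$, with $a/b+c/d=(ad+bc)/(bd)$ and $(a/b)(c/d)=(ac)/(bd)$; $S$ is viewed inside $Q(S)$ via $s\mapsto s/1$. A fractional ideal of $S$ is a nonempty subset $I\subseteq Q(S)$ closed under addition and under multiplication by elements of $S$, such that $dI\subseteq S$ for some MC element $d\in S$. The product of fractional ideals is $IJ=\{a_1b_1+\cdots+a_nb_n: a_i\in I,\ b_i\in J\}$. A fractional ideal (in particular an ideal) $I$ of $S$ is invertible if $IJ=S$ for some fractional ideal $J$ of $S$. A semiring $S$ is a Prüfer semiring if every nonzero finitely generated ideal of $S$ is invertible. *)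

(* Defs.v *)
From HB Require Import structures.
From mathcomp Require Import all_boot all_order all_algebra.
From mathcomp Require Import generic_quotient.
From mathcomp Require Import ring.
From mathcomp Require Import mathcomp_extra boolp classical_sets functions cardinality.

Set Implicit Arguments.
Unset Strict Implicit.
Unset Printing Implicit Defensive.

Import GRing.Theory.
Local Open Scope classical_set_scope.
Local Open Scope quotient_scope.
Local Open Scope ring_scope.

(* A semiring is a [comNzSemiRingType]: multiplication is
   commutative and 1 != 0, but there is no subtraction. An element is
   multiplicatively cancellable when it satisfies [GRing.lreg]. *)

Section Ideals.
Variable S : comNzSemiRingType.
Implicit Types (A I J K : set S) (s : S).

Definition is_ideal I : Prop :=
  [/\ I !=set0,
      forall a b, I a -> I b -> I (a + b) &
      forall s a, I a -> I (s * a)].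

Definition ideal_gen A : set S := smallest is_ideal A.

Definition fg_ideal I : Prop := exists2 A, finite_set A & I = ideal_gen A.

(* Both operations are stated for arbitrary subsets, so that [mul_set] also
   gives the product of fractional ideals, which are subsets of [Qt S]. The
   empty sum (n = 0) adds nothing new, as ideals and fractional ideals
   contain 0. *)
Definition add_set I J : set S := [set a + b | a in I & b in J].

Definition mul_set I J : set S :=
  [set x | exists n (a b : 'I_n -> S),
     [/\ forall i, I (a i), forall i, J (b i) & x = \sum_(i < n) a i * b i]].

Lemma is_ideal0 I : is_ideal I -> I 0.
Proof. by case=> -[a Ia] _ /(_ 0 a Ia); rewrite mul0r. Qed.

Lemma is_ideal_sum I (T : Type) (r : seq T) (P : pred T) (F : T -> S) :
  is_ideal I -> (forall i, P i -> I (F i)) -> I (\sum_(i <- r | P i) F i).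
Proof.
move=> hI IF; elim/big_ind: _ => //; first exact: is_ideal0.
by case: hI => _ ID _; apply: ID.
Qed.

Lemma ideal_gen_ideal A : is_ideal (ideal_gen A).
Proof.
split; first by exists 0 => I [/is_ideal0].
- move=> a b Ia Ib I [hI AI]; case: (hI) => _ ID _.
  by apply: ID; [apply: Ia | apply: Ib].
- move=> s a Ia I [hI AI]; case: (hI) => _ _ IM.
  by apply: IM; apply: Ia.
Qed.

Lemma ideal_gen0 A : ideal_gen A 0.
Proof. by apply: is_ideal0; apply: ideal_gen_ideal. Qed.

Lemma ideal_genS A : A `<=` ideal_gen A.
Proof. exact: sub_gen_smallest. Qed.

Lemma ideal_gen_sub A I : is_ideal I -> A `<=` I -> ideal_gen A `<=` I.
Proof. exact: smallest_sub. Qed.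

Lemma fg_ideal_ideal I : fg_ideal I -> is_ideal I.
Proof. by case=> A _ ->; apply: ideal_gen_ideal. Qed.

Lemma add_set_ideal I J : is_ideal I -> is_ideal J -> is_ideal (add_set I J).
Proof.
move=> hI hJ; have [_ ID IM] := hI; have [_ JD JM] := hJ; split.
- by exists (0 + 0); exists 0; [exact: is_ideal0 | exists 0; [exact: is_ideal0|]].
- move=> _ _ [a Ia [b Jb <-]] [c Ic [d Jd <-]].
  by exists (a + c); [exact: ID | exists (b + d); [exact: JD | rewrite addrACA]].
- move=> s _ [a Ia [b Jb <-]].
  by exists (s * a); [exact: IM | exists (s * b); [exact: JM | rewrite mulrDr]].
Qed.

Lemma mul_set_mem I J a b : I a -> J b -> mul_set I J (a * b).
Proof.
by move=> Ia Jb; exists 1%N, (fun=> a), (fun=> b); split=> //; rewrite big_ord1.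
Qed.

Lemma mul_set_ideal I J : is_ideal I -> is_ideal J -> is_ideal (mul_set I J).
Proof.
move=> hI hJ; have [_ ID IM] := hI; split.
- by exists (0 * 0); apply: mul_set_mem; apply: is_ideal0.
- move=> _ _ [m [a [b [Ia Jb ->]]]] [n [c [d [Ic Jd ->]]]].
  exists (m + n)%N,
    (fun i : 'I_(m + n) =>
       match fintype.split i with inl j => a j | inr j => c j end),
    (fun i : 'I_(m + n) =>
       match fintype.split i with inl j => b j | inr j => d j end).
  split; [by move=> i; case: fintype.splitP|by move=> i; case: fintype.splitP|].
  rewrite big_split_ord /=; congr (_ + _); apply: eq_bigr => i _.
    by rewrite -[lshift n i]/(unsplit (inl i)) unsplitK.
  by rewrite -[rshift m i]/(unsplit (inr i)) unsplitK.
- move=> s _ [m [a [b [Ia Jb ->]]]]; exists m, (fun i => s * a i), b.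
  split=> // [i|]; first exact: IM.
  by rewrite mulr_sumr; apply: eq_bigr => i _; rewrite mulrA.
Qed.

Lemma mul_set_sub I J K : is_ideal K ->
  (forall a b, I a -> J b -> K (a * b)) -> mul_set I J `<=` K.
Proof.
by move=> hK h _ [n [a [b [Ia Jb ->]]]]; apply: is_ideal_sum => // i _; apply: h.
Qed.

Lemma add_set_gen A B :
  add_set (ideal_gen A) (ideal_gen B) = ideal_gen (A `|` B).
Proof.
apply/seteqP; split.
- move=> _ [a Ia [b Jb <-]]; have [_ D _] := ideal_gen_ideal (A `|` B).
  apply: D.
    apply: ideal_gen_sub Ia; first exact: ideal_gen_ideal.
    by move=> x Ax; apply: ideal_genS; left.
  apply: ideal_gen_sub Jb; first exact: ideal_gen_ideal.
  by move=> x Ax; apply: ideal_genS; right.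
- apply: ideal_gen_sub; first by apply: add_set_ideal; exact: ideal_gen_ideal.
  move=> x [Ax|Bx].
    exists x; first exact: ideal_genS.
    by exists 0; [exact: ideal_gen0 | rewrite addr0].
  exists 0; first exact: ideal_gen0.
  by exists x; [exact: ideal_genS | rewrite add0r].
Qed.

Lemma mul_set_gen A B :
  mul_set (ideal_gen A) (ideal_gen B) = ideal_gen [set a * b | a in A & b in B].
Proof.
set C := [set a * b | a in A & b in B].
have [C0 CD CM] := ideal_gen_ideal C.
apply/seteqP; split; last first.
  apply: ideal_gen_sub; first by apply: mul_set_ideal; apply: ideal_gen_ideal.
  by move=> _ [a Aa [b Bb <-]]; apply: mul_set_mem; apply: ideal_genS.
apply: mul_set_sub; first exact: ideal_gen_ideal.
have stepB a : A a -> ideal_gen B `<=` [set b | ideal_gen C (a * b)].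
  move=> Aa; apply: ideal_gen_sub => [|b Bb]; last first.
    by apply: ideal_genS; exists a => //; exists b.
  split => [|x y /= Cx Cy|s x /= Cx]; first by exists 0; rewrite /= mulr0; apply: ideal_gen0.
    by rewrite mulrDr; apply: CD.
  by rewrite mulrCA; apply: CM.
move=> a b Ia Ib.
suff: ideal_gen A `<=` [set a | ideal_gen C (a * b)] by apply.
apply: ideal_gen_sub => [|x Ax]; last exact: stepB.
split => [|x y /= Cx Cy|s x /= Cx]; first by exists 0; rewrite /= mul0r; apply: ideal_gen0.
  by rewrite mulrDl; apply: CD.
by rewrite -mulrA; apply: CM.
Qed.

Lemma fg_ideal_add I J : fg_ideal I -> fg_ideal J -> fg_ideal (add_set I J).
Proof.
move=> [A fA ->] [B fB ->]; exists (A `|` B); last exact: add_set_gen.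
by rewrite finite_setU.
Qed.

Lemma fg_ideal_mul I J : fg_ideal I -> fg_ideal J -> fg_ideal (mul_set I J).
Proof.
move=> [A fA ->] [B fB ->]; exists [set a * b | a in A & b in B].
  exact: finite_image2.
exact: mul_set_gen.
Qed.

Lemma is_ideal_zero : is_ideal [set 0].
Proof.
split; first by exists 0.
  by move=> _ _ -> ->; rewrite /= addr0.
by move=> s _ ->; rewrite /= mulr0.
Qed.

Lemma is_ideal_setT : is_ideal setT.
Proof. by split=> //; exists 0. Qed.

Lemma fg_ideal_zero : fg_ideal [set 0].
Proof.
exists set0; first exact: finite_set0.
apply/seteqP; split; last by apply: ideal_gen_sub; first exact: is_ideal_zero.
by move=> _ ->; apply: ideal_gen0.
Qed.

Lemma fg_ideal_setT : fg_ideal setT.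
Proof.
exists [set 1]; first exact: finite_set1.
apply/seteqP; split=> // x _; rewrite -[x]mulr1.
by have [_ _ M] := ideal_gen_ideal [set 1]; apply: M; apply: ideal_genS.
Qed.

End Ideals.

Record FId (S : comNzSemiRingType) : Type := MkFId {
  fid_set :> set S;
  fid_fg : `[< fg_ideal fid_set >]
}.

HB.instance Definition _ S := [isSub for @fid_set S].
HB.instance Definition _ S := [Choice of FId S by <:].

Section FIdSemiring.
Variable S : comNzSemiRingType.
Implicit Types I J K : FId S.

Lemma fidP I : fg_ideal I.
Proof. exact/asboolP/fid_fg. Qed.

Lemma fid_ideal I : is_ideal I.
Proof. by apply: fg_ideal_ideal; apply: fidP. Qed.

Lemma fid0 I : (I : set S) 0.
Proof. by apply: is_ideal0; apply: fid_ideal. Qed.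

Definition fid_zero : FId S := MkFId (asboolT (@fg_ideal_zero S)).
Definition fid_one : FId S := MkFId (asboolT (@fg_ideal_setT S)).
Definition fid_add I J : FId S :=
  MkFId (asboolT (fg_ideal_add (fidP I) (fidP J))).
Definition fid_mul I J : FId S :=
  MkFId (asboolT (fg_ideal_mul (fidP I) (fidP J))).

Lemma fid_addA : associative fid_add.
Proof.
move=> I J K; apply: val_inj; apply/seteqP; split=> x /=.
  move=> [a Ia [_ [b Jb [c Kc <-]] <-]]; exists (a + b); last by exists c; rewrite // addrA.
  by exists a => //; exists b.
move=> [_ [a Ia [b Jb <-]] [c Kc <-]]; exists a => //.
by exists (b + c); [exists b => //; exists c | rewrite addrA].
Qed.

Lemma fid_addC : commutative fid_add.
Proof.
move=> I J; apply: val_inj; apply/seteqP; split=> _ /= [a Ia [b Jb <-]];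
by exists b => //; exists a => //; rewrite addrC.
Qed.

Lemma fid_add0 : left_id fid_zero fid_add.
Proof.
move=> I; apply: val_inj; apply/seteqP; split=> x /=.
  by move=> [_ -> [b Ib <-]]; rewrite add0r.
by move=> Ix; exists 0 => //; exists x; rewrite ?add0r.
Qed.

Lemma fid_mulC : commutative fid_mul.
Proof.
move=> I J; apply: val_inj; apply/seteqP; split;
  apply: mul_set_sub => [|a b Ia Jb]; try exact: fid_ideal (fid_mul _ _).
  by rewrite mulrC; apply: mul_set_mem.
by rewrite mulrC; apply: mul_set_mem.
Qed.

Lemma fid_mulA_sub I J K :
  mul_set I (mul_set J K) `<=` mul_set (mul_set I J) K.
Proof.
have H := fid_ideal (fid_mul (fid_mul I J) K).
apply: mul_set_sub => // a _ Ia [n [b [c [Jb Kc ->]]]].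
rewrite mulr_sumr; apply: is_ideal_sum => // i _; rewrite mulrA.
by do 2?apply: mul_set_mem.
Qed.

Lemma fid_mulA : associative fid_mul.
Proof.
move=> I J K; apply: val_inj; apply/seteqP; split; first exact: fid_mulA_sub.
change (fid_mul (fid_mul I J) K `<=` fid_mul I (fid_mul J K)).
rewrite (fid_mulC I J) (fid_mulC _ K) (fid_mulC J K) (fid_mulC I).
exact: fid_mulA_sub.
Qed.

Lemma fid_mul1 : left_id fid_one fid_mul.
Proof.
move=> I; have hI := fid_ideal I; apply: val_inj; apply/seteqP; split=> /=.
  by apply: mul_set_sub => // a b _; case: hI => _ _; apply.
by move=> x Ix; rewrite -[x]mul1r; apply: mul_set_mem.
Qed.

Lemma fid_mulDl : left_distributive fid_mul fid_add.
Proof.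
move=> I J K; apply: val_inj; apply/seteqP; split.
  apply: mul_set_sub; first exact: fid_ideal (fid_add _ _).
  move=> _ c [a Ia [b Jb <-]] Kc; exists (a * c); first exact: mul_set_mem.
  by exists (b * c); [exact: mul_set_mem | rewrite mulrDl].
have H := fid_ideal (fid_mul (fid_add I J) K).
move=> _ [x IKx [y JKy <-]]; have [_ D _] := H; apply: D.
  apply: mul_set_sub IKx => // a c Ia Kc; apply: mul_set_mem => //.
  by exists a => //; exists 0; [exact: fid0 | rewrite addr0].
apply: mul_set_sub JKy => // b c Jb Kc; apply: mul_set_mem => //.
by exists 0; [exact: fid0 | exists b; rewrite ?add0r].
Qed.

Lemma fid_mul0 : left_zero fid_zero fid_mul.
Proof.
move=> I; apply: val_inj; apply/seteqP; split=> /=.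
  by apply: mul_set_sub => [|a b -> _]; [exact: is_ideal_zero | rewrite /= mul0r].
by move=> _ ->; apply: (fid0 (fid_mul fid_zero I)).
Qed.

Lemma fid_oner_neq0 : fid_one != fid_zero.
Proof.
apply/eqP => /(congr1 (@fid_set S)) /= /seteqP [/(_ 1 I) /= /eqP].
by rewrite oner_eq0.
Qed.

HB.instance Definition _ :=
  GRing.isNmodule.Build (FId S) fid_addA fid_addC fid_add0.
HB.instance Definition _ :=
  GRing.Nmodule_isComNzSemiRing.Build (FId S) fid_mulA fid_mulC fid_mul1
    fid_mulDl fid_mul0 fid_oner_neq0.

Lemma fidDE I J : fid_set (I + J) = add_set I J. Proof. by []. Qed.
Lemma fidME I J : fid_set (I * J) = mul_set I J. Proof. by []. Qed.
Lemma fid0E : fid_set (0 : FId S) = [set 0]. Proof. by []. Qed.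
Lemma fid1E : fid_set (1 : FId S) = setT. Proof. by []. Qed.

End FIdSemiring.

Record mcancel (S : comNzSemiRingType) : Type := MkMcancel {
  mc_val : S;
  mc_reg : `[< GRing.lreg mc_val >]
}.

HB.instance Definition _ S := [isSub for @mc_val S].
HB.instance Definition _ S := [Choice of mcancel S by <:].

Section TotalQuotient.
Variable S : comNzSemiRingType.

Notation pair := (S * mcancel S)%type.

Lemma mcP (m : mcancel S) : GRing.lreg (mc_val m).
Proof. exact/asboolP/mc_reg. Qed.

Definition mc_one : mcancel S := @MkMcancel S 1 (asboolT (@lreg1 S)).
Definition mc_mul (m n : mcancel S) : mcancel S :=
  @MkMcancel S (mc_val m * mc_val n) (asboolT (lregM (@mcP m) (@mcP n))).

Definition frac_eqv (x y : pair) : bool :=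
  `[< exists t : mcancel S,
        mc_val t * x.1 * mc_val y.2 = mc_val t * mc_val x.2 * y.1 >].

Lemma frac_eqvP (x y : pair) :
  reflect (exists t : mcancel S,
        mc_val t * x.1 * mc_val y.2 = mc_val t * mc_val x.2 * y.1)
          (frac_eqv x y).
Proof. exact: asboolP. Qed.

Lemma frac_eqv_refl : reflexive frac_eqv.
Proof. by move=> x; apply/frac_eqvP; exists mc_one; rewrite -!mulrA (mulrC x.1). Qed.

Lemma frac_eqv_sym : symmetric frac_eqv.
Proof.
by move=> x y; apply/frac_eqvP/frac_eqvP => -[t e]; exists t;
  rewrite mulrAC -e mulrAC.
Qed.

Lemma frac_eqv_trans : transitive frac_eqv.
Proof.
move=> y x z /frac_eqvP[t e] /frac_eqvP[u f]; apply/frac_eqvP.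
exists (mc_mul (mc_mul t u) y.2) => /=.
transitivity ((mc_val t * x.1 * mc_val y.2) * (mc_val u * mc_val z.2));
  first by ring.
rewrite e; transitivity (mc_val t * mc_val x.2 * (mc_val u * y.1 * mc_val z.2));
  first by ring.
by rewrite f; ring.
Qed.

Canonical frac_eqv_equiv :=
  EquivRel frac_eqv frac_eqv_refl frac_eqv_sym frac_eqv_trans.

(* The total quotient semiring Q(S), localizing S at its cancellable elements. *)
Definition Qt : Type := {eq_quot frac_eqv}.
HB.instance Definition _ : EqQuotient _ frac_eqv Qt := EqQuotient.on Qt.
HB.instance Definition _ := Choice.on Qt.

Definition mkfrac (a : S) (m : mcancel S) : Qt := \pi_Qt (a, m).

Lemma mkfrac_eqP a m b n :
  mkfrac a m = mkfrac b n <->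
  exists t : mcancel S, mc_val t * a * mc_val n = mc_val t * mc_val m * b.
Proof.
split=> [/eqmodP /frac_eqvP //|h].
by apply/eqmodP; apply/frac_eqvP.
Qed.

Lemma mkfracE (x : Qt) : x = mkfrac (repr x).1 (repr x).2.
Proof. by rewrite /mkfrac -surjective_pairing reprK. Qed.

Definition q_add (x y : Qt) : Qt :=
  mkfrac ((repr x).1 * mc_val (repr y).2 + mc_val (repr x).2 * (repr y).1)
         (mc_mul (repr x).2 (repr y).2).
Definition q_mul (x y : Qt) : Qt :=
  mkfrac ((repr x).1 * (repr y).1) (mc_mul (repr x).2 (repr y).2).

Lemma q_addE a m b n :
  q_add (mkfrac a m) (mkfrac b n) = mkfrac (a * mc_val n + mc_val m * b) (mc_mul m n).
Proof.
have /mkfrac_eqP[t e] := mkfracE (mkfrac a m).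
have /mkfrac_eqP[u f] := mkfracE (mkfrac b n).
rewrite /q_add; move: (repr _) (repr _) e f => [b' n'] [a' m'] /= e f.
apply/mkfrac_eqP; exists (mc_mul t u) => /=.
transitivity ((mc_val t * mc_val m * a') * (mc_val u * mc_val n * mc_val n')
  + (mc_val u * mc_val n * b') * (mc_val t * mc_val m * mc_val m'));
  first by ring.
by rewrite -e -f; ring.
Qed.

Lemma q_mulE a m b n :
  q_mul (mkfrac a m) (mkfrac b n) = mkfrac (a * b) (mc_mul m n).
Proof.
have /mkfrac_eqP[t e] := mkfracE (mkfrac a m).
have /mkfrac_eqP[u f] := mkfracE (mkfrac b n).
rewrite /q_mul; move: (repr _) (repr _) e f => [b' n'] [a' m'] /= e f.
apply/mkfrac_eqP; exists (mc_mul t u) => /=.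
transitivity ((mc_val t * mc_val m * a') * (mc_val u * mc_val n * b'));
  first by ring.
by rewrite -e -f; ring.
Qed.

Definition tofracQ (s : S) : Qt := mkfrac s mc_one.

Lemma q_addA : associative q_add.
Proof.
move=> x y z; rewrite (mkfracE x) (mkfracE y) (mkfracE z) !q_addE.
by apply/mkfrac_eqP; exists mc_one => /=; ring.
Qed.

Lemma q_addC : commutative q_add.
Proof.
move=> x y; rewrite (mkfracE x) (mkfracE y) !q_addE.
by apply/mkfrac_eqP; exists mc_one => /=; ring.
Qed.

Lemma q_add0 : left_id (tofracQ 0) q_add.
Proof.
move=> x; rewrite (mkfracE x) q_addE.
by apply/mkfrac_eqP; exists mc_one => /=; ring.
Qed.

Lemma q_mulA : associative q_mul.
Proof.
move=> x y z; rewrite (mkfracE x) (mkfracE y) (mkfracE z) !q_mulE.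
by apply/mkfrac_eqP; exists mc_one => /=; ring.
Qed.

Lemma q_mulC : commutative q_mul.
Proof.
move=> x y; rewrite (mkfracE x) (mkfracE y) !q_mulE.
by apply/mkfrac_eqP; exists mc_one => /=; ring.
Qed.

Lemma q_mul1 : left_id (tofracQ 1) q_mul.
Proof.
move=> x; rewrite (mkfracE x) q_mulE.
by apply/mkfrac_eqP; exists mc_one => /=; ring.
Qed.

Lemma q_mulDl : left_distributive q_mul q_add.
Proof.
move=> x y z; rewrite (mkfracE x) (mkfracE y) (mkfracE z) !(q_addE, q_mulE).
by apply/mkfrac_eqP; exists mc_one => /=; ring.
Qed.

Lemma q_mul0 : left_zero (tofracQ 0) q_mul.
Proof.
move=> x; rewrite (mkfracE x) q_mulE.
by apply/mkfrac_eqP; exists mc_one => /=; ring.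
Qed.

Lemma q_oner_neq0 : tofracQ 1 != tofracQ 0.
Proof.
apply/eqP => /mkfrac_eqP [t /=]; rewrite -!mulrA mulr1 mul1r.
by move=> /(@mcP t) /eqP; rewrite oner_eq0.
Qed.

HB.instance Definition _ := GRing.isNmodule.Build Qt q_addA q_addC q_add0.
HB.instance Definition _ :=
  GRing.Nmodule_isComNzSemiRing.Build Qt q_mulA q_mulC q_mul1
    q_mulDl q_mul0 q_oner_neq0.

Lemma mkfracD a m b n : mkfrac a m + mkfrac b n =
  mkfrac (a * mc_val n + mc_val m * b) (mc_mul m n).
Proof. exact: q_addE. Qed.

Lemma mkfracM a m b n : mkfrac a m * mkfrac b n = mkfrac (a * b) (mc_mul m n).
Proof. exact: q_mulE. Qed.

Definition is_fractional_ideal (I : set Qt) : Prop :=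
  [/\ I !=set0,
      forall x y, I x -> I y -> I (x + y),
      forall (s : S) x, I x -> I (tofracQ s * x) &
      exists2 d : S, GRing.lreg d &
        [set tofracQ d * x | x in I] `<=` range tofracQ].

Definition invertible (I : set Qt) : Prop :=
  exists2 J, is_fractional_ideal J & mul_set I J = range tofracQ.

End TotalQuotient.

Definition pruefer (S : comNzSemiRingType) : Prop :=
  forall I : set S, fg_ideal I -> I <> [set 0] ->
    invertible [set tofracQ a | a in I].

(* The indices beyond the degree only contribute the coefficient 0. *)
Definition content (S : comNzSemiRingType) (f : {poly S}) : set S :=
  ideal_gen (range (fun i : nat => f`_i)).

Definition gaussian (S : comNzSemiRingType) : Prop :=
  forall f g : {poly S}, content (f * g) = mul_set (content f) (content g).

Definition subtractive_ideal (S : comNzSemiRingType) (I : set S) : Prop :=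
  forall a b, I (a + b) -> I a -> I b.

Definition subtractive (S : comNzSemiRingType) : Prop :=
  forall I : set S, is_ideal I -> subtractive_ideal I.

Definition additively_idempotent (S : comNzSemiRingType) : Prop :=
  forall s : S, s + s = s.

Definition semidomain (S : comNzSemiRingType) : Prop :=
  forall s : S, s != 0 -> GRing.lreg s.

(* Main.v *)
Require Import Defs.
From mathcomp Require Import all_boot all_order all_algebra.
From mathcomp Require Import ring.
From mathcomp Require Import boolp classical_sets cardinality.

(** The whole theorem rests on two facts about FId(S), where I + J is the join
    of I and J for inclusion.

    To contain is to divide ([sum_divides_FId]): if I is contained in J, with J
    nonzero, then I = J * (J^-1 * I), and J^-1 * I is a finitely generated
    ideal of S.  Taking the join I + J for the larger ideal, the sum of two
    elements of FId(S) divides each of them.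

    Nonzero elements cancel ([semidomain_FId]): multiply by the inverse.

    The rest is formal and holds in any semiring T where a + b always divides a.
    An ideal containing a + b contains its multiple b, so T is subtractive.  A
    finitely generated ideal is principal, generated by the sum of its
    generators; if moreover T is a semidomain, that generator a is cancellable
    when the ideal is nonzero, and the multiples of 1/a form an inverse.  In
    particular the content of a polynomial f is the principal ideal of f(1), so
    that T is Gaussian because evaluation at 1 is multiplicative.  Finally, when
    addition is idempotent, (a + b)(a^2 + ab + b^2) = (a + b)(a^2 + b^2), since
    the terms a^2 b and a b^2, which occur twice on the left, may as well occur
    once; cancelling a + b gives ab + (a^2 + b^2) = a^2 + b^2, and as T is
    subtractive, ab belongs to the ideal generated by a^2 and b^2. *)

Set Implicit Arguments.
Unset Strict Implicit.
Unset Printing Implicit Defensive.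

Import GRing.Theory.
Local Open Scope classical_set_scope.
Local Open Scope ring_scope.

(** * Principal ideals and their inverses *)

Section Principal.
Variable S : comNzSemiRingType.
Implicit Types (a b s : S).

Lemma ideal_gen1E a : ideal_gen [set a] = range ( *%R a).
Proof.
have [_ _ M] := ideal_gen_ideal [set a].
apply/seteqP; split; last first.
  by move=> _ [c _ <-]; rewrite mulrC; apply: M; apply: ideal_genS.
apply: ideal_gen_sub; last by move=> _ ->; exists 1; rewrite ?mulr1.
split; first by exists (a * 0); exists 0.
  by move=> _ _ [c _ <-] [d _ <-]; exists (c + d); rewrite ?mulrDr.
by move=> s _ [c _ <-]; exists (s * c); rewrite // mulrCA.
Qed.

Lemma tofracQ_inj : injective (@tofracQ S).
Proof.
by move=> a b /mkfrac_eqP[t /=]; rewrite !mulr1 => /(@mcP _ t).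
Qed.

Lemma tofracQD a b : tofracQ (a + b) = tofracQ a + tofracQ b.
Proof. by rewrite mkfracD; apply/mkfrac_eqP; exists (mc_one S) => /=; ring. Qed.

Lemma tofracQM a b : tofracQ (a * b) = tofracQ a * tofracQ b.
Proof. by rewrite mkfracM; apply/mkfrac_eqP; exists (mc_one S) => /=; ring. Qed.

Lemma tofracQ_sum n (F : 'I_n -> S) :
  tofracQ (\sum_(i < n) F i) = \sum_(i < n) tofracQ (F i).
Proof. exact: (big_morph _ tofracQD (erefl _)). Qed.

Lemma mkfracK (m : mcancel S) s : tofracQ (mc_val m) * mkfrac s m = tofracQ s.
Proof. by rewrite mkfracM; apply/mkfrac_eqP; exists (mc_one S) => /=; ring. Qed.

(** The inverse of the ideal generated by [a] consists of the fractions with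
    denominator [a]. *)
Lemma invertible_principal a :
  GRing.lreg a -> invertible [set tofracQ x | x in ideal_gen [set a]].
Proof.
move=> reg_a; pose m := MkMcancel (asboolT reg_a).
exists (range (fun s => mkfrac s m)).
  split; first by exists (mkfrac 0 m); exists 0.
  - move=> _ _ [s _ <-] [t _ <-]; exists (s + t) => //.
    by rewrite mkfracD; apply/mkfrac_eqP; exists (mc_one S) => /=; ring.
  - move=> r _ [s _ <-]; exists (r * s) => //.
    by rewrite mkfracM; apply/mkfrac_eqP; exists (mc_one S) => /=; ring.
  - by exists a => // _ [_ [s _ <-] <-]; exists s; rewrite ?(mkfracK m).
rewrite ideal_gen1E; apply/seteqP; split.
  move=> _ [n [x [y [xI yJ ->]]]].
  have xy_int i : exists s, tofracQ s = x i * y i.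
    have [_ [c _ <-] <-] := xI i; have [s _ <-] := yJ i.
    by exists (c * s); rewrite (mulrC a) !tofracQM -mulrA (mkfracK m).
  have [z zE] := choice xy_int; exists (\sum_(i < n) z i) => //.
  by rewrite tofracQ_sum; apply: eq_bigr => i _.
move=> _ [s _ <-]; rewrite -(mkfracK m); apply: mul_set_mem; last by exists s.
by exists a => //; exists 1; rewrite ?mulr1.
Qed.

End Principal.

(** * Semirings in which sums divide their terms *)

Definition sum_divides (T : comNzSemiRingType) : Prop :=
  forall a b : T, exists c, a = (a + b) * c.

Section SumDivides.
Variable T : comNzSemiRingType.
Hypothesis divT : sum_divides T.
Implicit Types (a b : T) (s : seq T).

Lemma sum_divides_subtractive : subtractive T.
Proof.
move=> I [_ _ IM] a b Iab _; have [c ->] := divT b a.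
by rewrite mulrC addrC; apply: IM.
Qed.

(** Finitely generated ideals are principal. *)
Lemma ideal_gen_seq s : ideal_gen [set` s] = ideal_gen [set \sum_(x <- s) x].
Proof.
apply/seteqP; split; apply: ideal_gen_sub; try exact: ideal_gen_ideal.
  move=> x /= xs; rewrite ideal_gen1E (big_rem x xs) /=.
  by have [c xE] := divT x (\sum_(y <- rem x s) y); exists c.
move=> _ ->; rewrite big_seq; apply: is_ideal_sum => [|x xs].
  exact: ideal_gen_ideal.
exact: ideal_genS.
Qed.

Lemma content_horner1 (f : {poly T}) : content f = ideal_gen [set f.[1]].
Proof.
(* The coefficient 0 is reached beyond the degree, hence the head of the list. *)
have -> : content f = ideal_gen [set` 0 :: f : seq T].
  congr ideal_gen; apply/seteqP; split => [_ [i _ <-]|x] /=.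
    rewrite inE; have [/(mem_nth 0) ->|/(nth_default 0) ->] := ltnP i (size f).
      by rewrite orbT.
    by rewrite eqxx.
  rewrite inE => /orP[/eqP ->|/(nthP 0)[i _ <-]]; last by exists i.
  by exists (size f); rewrite // nth_default.
rewrite ideal_gen_seq big_cons add0r horner_coef (big_nth 0) big_mkord.
by congr (ideal_gen [set _]); apply: eq_bigr => i _; rewrite expr1n mulr1.
Qed.

Lemma sum_divides_gaussian : gaussian T.
Proof.
move=> f g; rewrite !content_horner1 mul_set_gen hornerM; congr ideal_gen.
apply/seteqP; split=> [_ ->|_ [_ -> [_ -> <-]]] //.
by exists f.[1] => //; exists g.[1].
Qed.

Hypothesis domT : semidomain T.

Lemma sum_divides_pruefer : pruefer T.
Proof.
move=> I [A /finite_seqP[s ->] ->]; rewrite ideal_gen_seq => I_neq0.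
apply: invertible_principal; apply: domT; apply/eqP => sum0; apply: I_neq0.
rewrite sum0 ideal_gen1E; apply/seteqP; split=> [_ [c _ <-]|_ ->].
  by rewrite /= mul0r.
by exists 0; rewrite ?mulr0.
Qed.

Hypothesis idemT : additively_idempotent T.

Lemma sum_divides_mul_squares a b : ideal_gen [set a ^+ 2; b ^+ 2] (a * b).
Proof.
have hK := ideal_gen_ideal [set a ^+ 2; b ^+ 2]; have [_ KD KM] := hK.
have [Ka Kb] : ideal_gen [set a ^+ 2; b ^+ 2] (a ^+ 2) /\
               ideal_gen [set a ^+ 2; b ^+ 2] (b ^+ 2).
  by split; apply: ideal_genS; [left|right].
have [ab0|ab_neq0] := eqVneq (a + b) 0.
  have [c ->] := divT a b.
  by rewrite ab0 !mul0r; apply: ideal_gen0.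
have cube : (a + b) * (a ^+ 2 + b ^+ 2 + a * b) = (a + b) * (a ^+ 2 + b ^+ 2).
  transitivity (a ^+ 3 + b ^+ 3 + (a ^+ 2 * b + a ^+ 2 * b) +
                (a * b ^+ 2 + a * b ^+ 2)); first by ring.
  by rewrite !idemT; ring.
apply: (sum_divides_subtractive hK) (KD _ _ Ka Kb).
by rewrite (domT ab_neq0 cube); apply: KD.
Qed.

End SumDivides.

(** * Ideals of a Pruefer semiring *)

Section Pruefer.
Variable S : comNzSemiRingType.
Implicit Types I J K L : FId S.

Lemma fid_subDl I J : fid_set I `<=` fid_set (I + J).
Proof. by move=> x Ix; exists x => //; exists 0; [exact: fid0 | rewrite addr0]. Qed.

Lemma additively_idempotent_FId : additively_idempotent (FId S).
Proof.
move=> I; apply: val_inj; apply/seteqP; split; last exact: fid_subDl.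
by move=> _ [a Ia [b Ib <-]]; have [_ ID _] := fid_ideal I; apply: ID.
Qed.

(** An inverse of [I] contains elements [b i] with [\sum_i b i * a i = 1];
    multiplication by [b i] maps [I] into [S].  These maps [phi i] carry all
    that is needed of the inverse without leaving [S]. *)
Lemma invertible_dual_basis (I : set S) : is_ideal I ->
  invertible [set tofracQ x | x in I] ->
  exists n (a : 'I_n -> S) (phi : 'I_n -> S -> S),
    [/\ forall i, I (a i),
        forall i x y, I x -> I y -> phi i (x + y) = phi i x + phi i y,
        forall i s x, I x -> phi i (s * x) = s * phi i x &
        \sum_(i < n) phi i (a i) = 1].
Proof.
move=> [_ ID IM] [J _ IJ1].
have : range (@tofracQ S) 1 by exists 1.
rewrite -IJ1 => -[n [a' [b [a'I bJ sum1]]]].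
have a'_int i : exists x, I x /\ tofracQ x = a' i.
  by have [x] := a'I i; exists x.
have [a aE] := choice a'_int.
have bI_int (ix : 'I_n * S) :
    exists s, I ix.2 -> tofracQ s = b ix.1 * tofracQ ix.2.
  (* [phi] is only meaningful on [I]; elsewhere 0 is a default value. *)
  have [Ix|] := pselect (I ix.2); last by exists 0.
  have : mul_set [set tofracQ x | x in I] J (tofracQ ix.2 * b ix.1).
    by apply: mul_set_mem => //; exists ix.2.
  by rewrite IJ1 => -[s _ sE]; exists s => _; rewrite sE mulrC.
have [phi' phiP] := choice bI_int.
have {}phiP i x : I x -> tofracQ (phi' (i, x)) = b i * tofracQ x.
  exact: (phiP (i, x)).
exists n, a, (fun i x => phi' (i, x)); split.
- by move=> i; case: (aE i).
- move=> i x y Ix Iy; apply: tofracQ_inj.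
  by rewrite phiP ?tofracQD ?phiP ?mulrDr //; apply: ID.
- move=> i s x Ix; apply: tofracQ_inj.
  rewrite (phiP _ _ (IM _ _ Ix)) tofracQM (tofracQM s) (phiP _ _ Ix).
  exact: mulrCA.
- apply: tofracQ_inj; rewrite tofracQ_sum [RHS]sum1; apply: eq_bigr => i _.
  by have [Ia <-] := aE i; rewrite phiP // mulrC.
Qed.

Hypothesis hS : pruefer S.

Lemma fid_dual_basis I : I != 0 ->
  exists n (a : 'I_n -> S) (phi : 'I_n -> S -> S),
    [/\ forall i, fid_set I (a i),
        forall i x y, fid_set I x -> fid_set I y ->
          phi i (x + y) = phi i x + phi i y,
        forall i s x, fid_set I x -> phi i (s * x) = s * phi i x &
        \sum_(i < n) phi i (a i) = 1].
Proof.
move=> I_neq0; apply: invertible_dual_basis; first exact: fid_ideal.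
apply: hS; first exact: fidP.
by move=> I0; move/eqP: I_neq0; apply; apply: val_inj.
Qed.

(** If [k \in K], then [k = \sum_i phi i (a i * k)], where [a i * k] belongs to
    [I * K], hence to [I * L], and [phi i] maps [I * L] into [L]. *)
Lemma fid_mul_cancel_sub I K L : I != 0 ->
  fid_set (I * K) `<=` fid_set (I * L) -> fid_set K `<=` fid_set L.
Proof.
move=> /fid_dual_basis[n [a [phi [Ia phiD phiM sum1]]]] IKL k Kk.
have hI := fid_ideal I; have hL := fid_ideal L.
have [_ LD LM] := hL; have [_ ID IM] := hI.
rewrite -[k]mulr1 -sum1 mulr_sumr; apply: is_ideal_sum => // i _.
rewrite -phiM //.
suff IL_phi : mul_set I L `<=` [set x | fid_set I x /\ fid_set L (phi i x)].
  by have /IL_phi[] : mul_set I L (k * a i) by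
    apply: IKL; rewrite mulrC; apply: mul_set_mem.
apply: mul_set_sub => [|x y Ix Ly].
  split.
  - exists 0; split; first exact: is_ideal0.
    by rewrite -(mul0r (a i)) phiM // mul0r; apply: is_ideal0.
  - by move=> x y [Ix Lx] [Iy Ly]; split; [exact: ID | rewrite phiD //; exact: LD].
  - by move=> s x [Ix Lx]; split; [exact: IM | rewrite phiM //; exact: LM].
by split; rewrite mulrC ?phiM //; [exact: IM | rewrite mulrC; exact: LM].
Qed.

Lemma semidomain_FId : semidomain (FId S).
Proof.
move=> I I_neq0 K L IKL; apply: val_inj; apply/seteqP.
by split; apply: (fid_mul_cancel_sub I_neq0); rewrite IKL.
Qed.

(** The quotient [J^-1 * I] is generated by the finitely many [phi i g], where
    [g] runs over generators of [I] and [phi] over a dual basis of [J]. *)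
Lemma fid_sub_divides I J : J != 0 -> fid_set I `<=` fid_set J ->
  exists K, I = J * K.
Proof.
move=> /fid_dual_basis[n [a [phi [Ja _ phiM sum1]]]] IJ.
have [A finA IE] := fidP I; have [_ _ IM] := fid_ideal I.
have AI : A `<=` fid_set I by rewrite IE; apply: ideal_genS.
have phi_swap i x y : fid_set J x -> fid_set J y -> x * phi i y = y * phi i x.
  by move=> Jx Jy; rewrite -!phiM // mulrC.
pose B := [set phi i g | i in [set: 'I_n] & g in A].
have fgB : fg_ideal (ideal_gen B).
  by exists B => //; apply: finite_image2 => //; apply: finite_finset.
exists (MkFId (asboolT fgB)); apply: val_inj; apply/seteqP; split => /=.
  have hJK : is_ideal (mul_set J (ideal_gen B)).
    by apply: mul_set_ideal; [exact: fid_ideal | exact: ideal_gen_ideal].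
  rewrite {1}IE; apply: ideal_gen_sub => // g Ag.
  have Jg : fid_set J g by apply/IJ/AI.
  rewrite -[g]mulr1 -sum1 mulr_sumr; apply: is_ideal_sum => // i _.
  rewrite phi_swap //; apply: mul_set_mem => //.
  by apply: ideal_genS; exists i => //; exists g.
apply: mul_set_sub => [|x y Jx]; first exact: fid_ideal.
apply: (ideal_gen_sub (I := [set y | fid_set I (x * y)])) => [|_ [i _ [g Ag <-]]].
  have [_ ID _] := fid_ideal I; split.
  - by exists 0; rewrite /= mulr0; apply: fid0.
  - by move=> u v Iu Iv; rewrite /= mulrDr; apply: ID.
  - by move=> s u Iu; rewrite /= mulrCA; apply: IM.
by rewrite /= phi_swap //; [rewrite mulrC; apply: IM; apply: AI | apply/IJ/AI].
Qed.

Lemma sum_divides_FId : sum_divides (FId S).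
Proof.
move=> I J; have [IJ0|IJ_neq0] := eqVneq (I + J) 0; last first.
  exact: fid_sub_divides IJ_neq0 (@fid_subDl I J).
exists 0; rewrite mulr0; apply: val_inj; apply/seteqP; split=> x.
  by move=> /(@fid_subDl I J); rewrite IJ0.
by move=> ->; apply: fid0.
Qed.

End Pruefer.

Theorem theorem4p7 (S : comNzSemiRingType) (hS : pruefer S) :
  [/\ gaussian (FId S),
      subtractive (FId S),
      [/\ additively_idempotent (FId S),
          semidomain (FId S) &
          forall I J : FId S, ideal_gen [set I ^+ 2; J ^+ 2] (I * J)] &
      pruefer (FId S)].
Proof.
have divF := sum_divides_FId hS; have domF := semidomain_FId hS.
have idemF := @additively_idempotent_FId S; split.
- exact: sum_divides_gaussian.
- exact: sum_divides_subtractive.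
- by split=> // I J; apply: sum_divides_mul_squares.
- exact: sum_divides_pruefer.
Qed.
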